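(* Let $n\ge 7$ be an integer. Then $$\Theta(n)=[s(n-1)+1]\cup\{\mathrm{LCM}(p,q): p+q=n,\ p,q\in\mathbb{Z}^+\}\cup\{\infty\},$$ where $\Theta(n)$ is the set of stable indices of all 0-1 matrices of order $n$, $s(n-1)$ is the maximum finite stable index of 0-1 matrices of order $n-1$, and $[k]=\{1,2,\ldots,k\}$.
   Context: $\mathbb{Z}^+$ is the set of positive integers, $[k]=\{1,2,\ldots,k\}$ for $k\in\mathbb{Z}^+$, and $\mathrm{LCM}(p,q)$ is the least common multiple of $p$ and $q$. A 0-1 matrix of order $n$ is an $n\times n$ matrix all of whose entries lie in $\{0,1\}$; matrix powers are taken over the integers. Stable index: for a square 0-1 matrix $A$, the stable index $\theta(A)$ is the smallest positive integer $k$ such that $A^{k+1}$ is not a 0-1 matrix, if such an integer exists; otherwise $\theta(A)=\infty$. $\Theta(n)=\{\theta(A): A \text{ is a 0-1 matrix of order } n\}$, and $s(n)$ denotes the maximum finite stable index of 0-1 matrices of order $n$, i.e. $s(n)=\max\big(\Theta(n)\setminus\{\infty\}\big)$ (this maximum exists since there are only finitely many 0-1 matrices of order $n$). *)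

(* Defs.v *)
From HB Require Import structures.
From mathcomp Require Import all_boot all_order all_algebra.
From mathcomp Require Import boolp classical_sets.

Set Implicit Arguments.
Unset Strict Implicit.
Unset Printing Implicit Defensive.

Import Order.TTheory GRing.Theory Num.Theory.

Local Open Scope classical_set_scope.

Definition is01 n (A : 'M[int]_n) : bool :=
  [forall i, forall j, (A i j == 0%R) || (A i j == 1%R)].

Definition unstable_at n (A : 'M[int]_n) (k : nat) : bool :=
  (0 < k) && ~~ is01 (A ^+ k.+1)%R.

(* Values in option nat: Some k is the finite index k, None is infinity. *)
Definition stable_index n (A : 'M[int]_n) : option nat :=
  if pselect (exists k, unstable_at A k) is left h then Some (ex_minn h)
  else None.

Definition Theta (n : nat) : set (option nat) :=
  [set stable_index A | A in [set A : 'M[int]_n | is01 A]].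

Definition is_max (S : set nat) (m : nat) : Prop :=
  S m /\ forall k, S k -> k <= m.

(* Takes the junk value 0 when no stable index of order n is finite, that is
   for n < 2; max_stable_indexP below shows that it is the maximum if n >= 2. *)
Definition max_stable_index (n : nat) : nat :=
  xget 0 (is_max [set k | Theta n (Some k)]).

Lemma stable_index_SomeP n (A : 'M[int]_n) k :
  stable_index A = Some k <->
  unstable_at A k /\ forall j, unstable_at A j -> k <= j.
Proof.
rewrite /stable_index; case: pselect => [h|h]; last first.
  by split=> // -[Ak _]; case: h; exists k.
case: ex_minnP => m Am mmin; split=> [[<-]//|[Ak kmin]].
by congr Some; apply/eqP; rewrite eqn_leq mmin ?kmin.
Qed.

Lemma stable_index_NoneP n (A : 'M[int]_n) :
  stable_index A = None <-> forall k, 0 < k -> is01 (A ^+ k.+1)%R.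
Proof.
rewrite /stable_index; case: pselect => [h|h]; split=> //.
  by move=> h01; have [k /andP[k0 /negP[]]] := h; apply: h01.
by move=> _ k k0; apply/negPn/negP => Ak; apply: h; exists k; apply/andP.
Qed.

Lemma Theta_bounded n : exists b, forall k, Theta n (Some k) -> k <= b.
Proof.
pose F (B : 'M[bool]_n) := stable_index (map_mx (fun b : bool => Posz b) B).
exists (\max_(B : 'M[bool]_n) odflt 0 (F B)) => k [A /= A01 Ak].
pose B : 'M[bool]_n := map_mx (fun x : int => x == 1%R) A.
have AB : map_mx (fun b : bool => Posz b) B = A.
  apply/matrixP => i j; rewrite !mxE.
  by have /orP[/eqP ->|/eqP ->] := forallP (forallP A01 i) j.
have -> : k = odflt 0 (F B) by rewrite /F AB Ak.
exact: (leq_bigmax (F := fun B => odflt 0 (F B))).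
Qed.

Lemma Theta_1 n : 1 < n -> Theta n (Some 1).
Proof.
case: n => // n n1; exists (const_mx 1%R).
  by apply/forallP => i; apply/forallP => j; rewrite mxE eqxx orbT.
apply/stable_index_SomeP; split=> [|j /andP[]//].
apply/andP; split=> //; apply/negP => /forallP/(_ ord0) /forallP/(_ ord0).
rewrite expr2 mxE (eq_bigr (fun=> 1%R)) => [|i _]; last by rewrite !mxE mulr1.
by rewrite sumr_const card_ord natz; case: n n1.
Qed.

Lemma max_stable_indexP n : 1 < n ->
  is_max [set k | Theta n (Some k)] (max_stable_index n).
Proof.
move=> n1; rewrite /max_stable_index.
have [b bP] := Theta_bounded n.
have hex : exists k, `[< Theta n (Some k) >].
  by exists 1; apply/asboolP/Theta_1.
have hb k : `[< Theta n (Some k) >] -> k <= b by move=> /asboolP/bP.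
apply: (xgetPex 0); exists (ex_maxn hex hb).
by case: ex_maxnP => m /asboolP Tm mmax; split=> // k Tk; apply/mmax/asboolP.
Qed.

(* Main.v *)
Require Import Defs.
From mathcomp Require Import all_boot all_order all_algebra.
From mathcomp Require Import boolp classical_sets.
From mathcomp Require Import zify.

(* Read A as a digraph: the stable index is the least k such that two walks of
   length k + 1 with the same endpoints start with different arcs (a fork).

   A cycle of length p joined to a cycle of length q by a path of length d + 1
   has stable index LCM(p, q) + d. A further vertex with an arc into each of the
   two cycles (joined by a single arc) makes its walks that go through the first
   cycle meet those that go directly to the second one; by the Chinese remainder
   theorem the first meeting time can be any number of [1, LCM(p, q)].

   Conversely, a vertex with two out-neighbours in its strong component gives a
   fork of index at most n. Otherwise the nontrivial strong components are
   cycles. If a cycle of length p leads to one of length q, a shortest path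
   between them gives a fork of index at most LCM(p, q) + n - p - q; if moreover
   p + q = n, then either one arc joins the cycles and the index is LCM(p, q), or
   two arcs at distance t in the product of the cycles give forks of index t and
   LCM(p, q) - t, so the index is at most LCM(p, q) / 2. If no cycle leads to
   another one, each of the two walks winds around a single cycle, and the same
   bound holds with p + q < n since otherwise LCM(p, q) steps can be removed
   from both walks. Hence s(n - 1) is the maximum of LCM(p, q) + n - 1 - p - q
   over p + q < n, and LCM(p, q) with p + q = n is the only way to exceed
   s(n - 1) + 1. *)

Set Implicit Arguments.
Unset Strict Implicit.
Unset Printing Implicit Defensive.

Local Open Scope classical_set_scope.

(** * Forks and powers of 0-1 matrices *)

Section Walks.
Variables (T : eqType) (e : rel T).
Implicit Types (x y z a b : T) (s : seq T).

Definition walk m x y := exists s, [/\ path e x s, size s = m & last x s = y].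

(* Index shift: the two walks have length k + 1, so that the stable index is the
   least index of a fork. *)
Definition fork k := exists x a b y,
  [/\ a != b, e x a, e x b, walk k a y & walk k b y].

Definition least_fork k := fork k /\ forall j, fork j -> k <= j.

Lemma walk0 x y : walk 0 x y <-> x = y.
Proof.
split=> [[s [_ /size0nil -> //]]|->]; by exists [::].
Qed.

Lemma walk1 x y : e x y -> walk 1 x y.
Proof. by move=> exy; exists [:: y]; rewrite /= exy. Qed.

Lemma walk_cat m1 m2 x y z : walk m1 x y -> walk m2 y z -> walk (m1 + m2) x z.
Proof.
move=> [s1 [p1 <- <-]] [s2 [p2 <- <-]]; exists (s1 ++ s2).
by rewrite cat_path p1 p2 size_cat last_cat.
Qed.

Lemma walkS m x z : walk m.+1 x z <-> exists2 y, e x y & walk m y z.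
Proof.
split=> [[[|y s] [//= /andP[exy ps] [sz] lz]]|[y exy w]].
  by exists y => //; exists s.
by rewrite -add1n; apply: walk_cat w; apply: walk1.
Qed.

Lemma path_walk x s : path e x s -> walk (size s) x (last x s).
Proof. by exists s. Qed.

Lemma fork_gt0 k : fork k -> 0 < k.
Proof.
case: k => // -[x [a [b [y [nab _ _ /walk0 ay /walk0 by_]]]]].
by rewrite ay by_ eqxx in nab.
Qed.

(** The fork starts where the two walks first differ; what follows the differing arcs is shorter
    than [size s1]. *)
Lemma neq_walks_fork x s1 s2 : path e x s1 -> path e x s2 ->
  size s1 = size s2 -> last x s1 = last x s2 -> s1 <> s2 ->
  exists2 k, k < size s1 & fork k.
Proof.
elim: s1 x s2 => [x [|//]//|a s1 IH x [//|b s2]] /= /andP[xa p1] /andP[xb p2].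
move=> [sz] ls ne; have [eab|nab] := eqVneq a b.
  subst b; have [|k kl fk] := IH a s2 p1 p2 sz ls; last by exists k => //; lia.
  by move=> es; apply: ne; rewrite es.
exists (size s1) => //; exists x, a, b, (last a s1); split=> //.
  exact: path_walk.
by rewrite ls sz; apply: path_walk.
Qed.

Lemma fork_neq_walks k : fork k -> exists x s1 s2,
  [/\ path e x s1 /\ path e x s2, size s1 = k.+1 /\ size s2 = k.+1,
      last x s1 = last x s2 & s1 <> s2].
Proof.
move=> [x [a [b [y [nab xa xb [s1 [p1 z1 l1]] [s2 [p2 z2 l2]]]]]]].
exists x, (a :: s1), (b :: s2); split => /=; rewrite ?xa ?xb ?z1 ?z2 ?l1 ?l2 //.
by case=> ab; rewrite ab eqxx in nab.
Qed.

End Walks.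

Section Transfer.
Import Order.TTheory GRing.Theory Num.Theory.
Local Open Scope ring_scope.

Definition rel_of n (A : 'M[int]_n) : rel 'I_n := fun i j => A i j == 1.
Definition mx_of n (e : rel 'I_n) : 'M[int]_n := \matrix_(i, j) (e i j)%:R.

Lemma mx_of_01 n (e : rel 'I_n) : is01 (mx_of e).
Proof. by apply/forallP=> i; apply/forallP=> j; rewrite mxE; case: (e i j). Qed.

Lemma rel_ofK n (A : 'M[int]_n) : is01 A -> mx_of (rel_of A) = A.
Proof.
move=> A01; apply/matrixP=> i j; rewrite mxE /rel_of.
by have /orP[/eqP ->|/eqP ->] := forallP (forallP A01 i) j.
Qed.

Lemma mxpow_ge0 n (e : rel 'I_n) m i j : 0 <= (mx_of e ^+ m) i j.
Proof.
elim: m i j => [|m IH] i j; first by rewrite expr0 mxE; case: eqP.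
rewrite exprS mxE; apply: sumr_ge0 => c _.
by rewrite mulr_ge0 // mxE; case: (e i c).
Qed.

Lemma mxpow_walk n (e : rel 'I_n) m i j :
  (1 <= (mx_of e ^+ m) i j) <-> walk e m i j.
Proof.
elim: m i j => [|m IH] i j.
  by rewrite walk0 expr0 mxE; case: eqP.
rewrite walkS exprS mxE; split=> [sum1|[c ic /IH cj]].
  apply: contrapT => none; move: sum1; rewrite big1 // => c _.
  rewrite mxE; case ic: (e i c); last by rewrite mul0r.
  rewrite mul1r; apply/eqP; rewrite eq_le mxpow_ge0 andbT.
  by rewrite -ltzD1 ltNge; apply/negP=> /IH cj; apply: none; exists c.
rewrite (bigD1 c) //= mxE ic mul1r; apply: le_trans cj _; rewrite lerDl.
apply: sumr_ge0 => d _; by rewrite mulr_ge0 ?mxpow_ge0 // mxE; case: (e i d).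
Qed.

Lemma neq01_ge2 (z : int) : 0 <= z -> ~~ ((z == 0) || (z == 1)) -> 2 <= z.
Proof. lia. Qed.

Lemma ge2_neq01 (z : int) : 2 <= z -> ~~ ((z == 0) || (z == 1)).
Proof. lia. Qed.

Lemma fork_not01 n (e : rel 'I_n) k : fork e k -> ~~ is01 (mx_of e ^+ k.+1).
Proof.
move=> [x [a [b [y [nab xa xb /mxpow_walk way /mxpow_walk wby]]]]].
apply/negP=> /forallP/(_ x)/forallP/(_ y).
suff: 2 <= (mx_of e ^+ k.+1) x y.
  by case/ge2_neq01/norP=> /negPf-> /negPf->.
rewrite exprS mxE (bigD1 a) //= (bigD1 b) /=; last by rewrite eq_sym.
rewrite !mxE xa xb !mul1r addrA.
apply: le_trans (lerD way wby) _; rewrite lerDl.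
apply: sumr_ge0 => d _; by rewrite mulr_ge0 ?mxpow_ge0 // mxE; case: (e x d).
Qed.

(** An entry at least 2 comes either from two contributing out-neighbours, which give a fork, or
    from one whose own entry in the previous power is at least 2. *)
Lemma not01_fork n (e : rel 'I_n) m : ~~ is01 (mx_of e ^+ m) ->
  exists2 k, (k < m)%N & fork e k.
Proof.
rewrite negb_forall => /existsP[x]; rewrite negb_forall => /existsP[y].
move=> n01; have {n01} : 2 <= (mx_of e ^+ m) x y.
  exact: neq01_ge2 (mxpow_ge0 e m x y) n01.
elim: m x => [|m IH] x; first by rewrite expr0 mxE; case: eqP.
rewrite exprS mxE => sum2.
have [c xc cy] : exists2 c, e x c & 1 <= (mx_of e ^+ m) c y.
  have /walkS[c xc /mxpow_walk] : walk e m.+1 x y by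
    apply/mxpow_walk; rewrite exprS mxE; apply: le_trans sum2.
  by exists c.
have [/IH[k km]|small] := boolP (2 <= (mx_of e ^+ m) c y).
  by exists k => //; lia.
have [[d [nd xd dy]]|none] :=
  pselect (exists d, [/\ c != d, e x d & 1 <= (mx_of e ^+ m) d y]).
  exists m => //; exists x, c, d, y; split=> //; exact/mxpow_walk.
move: sum2; rewrite (bigD1 c) //= mxE xc mul1r big1 ?addr0.
  by rewrite (negPf small).
move=> d dc; rewrite mxE; case xd: (e x d); last by rewrite mul0r.
rewrite mul1r; apply/eqP; rewrite eq_le mxpow_ge0 andbT.
rewrite -ltzD1 ltNge; apply/negP=> dy; apply: none; exists d.
by rewrite eq_sym.
Qed.

(** A fork of index [k] spoils the power [k.+1], while a spoilt power only yields a fork of that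
    index or less; hence the minima agree. *)
Lemma stable_index_least_fork n (e : rel 'I_n) k :
  stable_index (mx_of e) = Some k <-> least_fork e k.
Proof.
rewrite stable_index_SomeP; split=> [[/andP[k0 /not01_fork[j jk fj]] kmin]|].
  have le_kP i : fork e i -> (k <= i)%N.
    by move=> fi; apply: kmin; rewrite /unstable_at (fork_gt0 fi) fork_not01.
  split=> //; have := le_kP _ fj; rewrite leq_eqVlt => /orP[/eqP -> //|]; lia.
move=> [fk kmin]; split; first by rewrite /unstable_at (fork_gt0 fk) fork_not01.
move=> j /andP[_ /not01_fork[i ij /kmin]]; lia.
Qed.

Lemma Theta_least_fork n k :
  Theta n (Some k) <-> exists e : rel 'I_n, least_fork e k.
Proof.
split=> [[A A01]|[e /stable_index_least_fork ek]]; last first.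
  by exists (mx_of e) => //; apply: mx_of_01.
rewrite -(rel_ofK A01) => /stable_index_least_fork fk.
by exists (rel_of A).
Qed.

Lemma Theta_None n : Theta n None.
Proof.
exists (mx_of (fun _ _ : 'I_n => false)); first exact: mx_of_01.
apply/stable_index_NoneP=> k _; apply/negPn/negP => /not01_fork[j _].
by move=> [x [a [b [y []]]]].
Qed.

End Transfer.

(** Lets the example digraphs be defined by arithmetic on [nat], without ordinals. *)
Lemma Theta_of_nat_rel n (R : rel nat) k :
  (forall u v, R u v -> u < n /\ v < n) -> least_fork R k -> Theta n (Some k).
Proof.
move=> Rn [fk kmin]; apply/Theta_least_fork; exists (relpre val R).
have walkP m (a b : 'I_n) : walk (relpre val R) m a b <-> walk R m (val a) (val b).
  elim: m a => [|m IH] a; first by rewrite !walk0; split=> [->//|/val_inj].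
  rewrite !walkS; split=> -[c ac cb]; first by exists (val c) => //; apply/IH.
  have [_ cn] := Rn _ _ ac.
  by exists (Ordinal cn) => //; apply/IH.
split.
  have [x [a [b [y [nab xa xb ay by_]]]]] := fk.
  have [[xn an] [_ bn]] := (Rn _ _ xa, Rn _ _ xb).
  have yn : y < n.
    have: 0 < k := fork_gt0 fk.
    move: ay => [s [ps <- <-]]; case/lastP: s ps => [//|s z].
    by rewrite rcons_path last_rcons => /andP[_ /Rn[]].
  exists (Ordinal xn), (Ordinal an), (Ordinal bn), (Ordinal yn).
  by split=> //; apply/walkP.
move=> j [x [a [b [y [nab xa xb /walkP ay /walkP by_]]]]].
by apply: kmin; exists (val x), (val a), (val b), (val y).
Qed.

(** * Digraphs with two cycles *)

Section Lollipop.
Variables (p q d : nat) (ws : seq nat).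
Hypotheses (p0 : 0 < p) (q0 : 0 < q).

Definition tail t := p + (if t < d then t else d + (t - d) %% q).

(* A cycle on [0, p), an arc from 0 to the vertex p, from which a path of
   length d leads to a cycle of length q (tail t is the vertex reached from p
   after t steps), and an extra vertex p + q + d with out-neighbours ws. *)
Definition lollipop : rel nat := fun u v =>
  [|| (u < p) && (v == u.+1 %% p), (u == 0) && (v == p),
      (p <= u < p + q + d) && (v == tail (u - p).+1)
    | (u == p + q + d) && (v \in ws)].

Lemma tail0 : tail 0 = p.
Proof. by rewrite /tail; case: d => [|d']; rewrite ?mod0n ?addn0. Qed.

Lemma tail_bounds t : p <= tail t < p + q + d.
Proof. by have := ltn_pmod (t - d) q0; rewrite /tail; case: ifP; lia. Qed.

Lemma tail_succ t : tail (tail t - p).+1 = tail t.+1.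
Proof.
rewrite /tail addKn; have [td|dt] := ltnP t d; first by [].
rewrite !ltnNge (leqW dt) -addnS leq_addr /= addKn.
by rewrite -addn1 modnDml addn1 subSn.
Qed.

(** The first [d] vertices of the tail are visited once; repetitions occur only on the final cycle,
    of length [q]. *)
Lemma tail_eq r c : 0 < c -> tail r = tail (r + c) -> d <= r /\ q %| c.
Proof.
move=> c0 /addnI; have [rd|dr] := ltnP r d.
  by case: ltnP => [|dc e]; [lia|have := leq_addr ((r + c - d) %% q) d; lia].
rewrite ltnNge (leq_trans dr) ?leq_addr //= => /addnI/eqP.
rewrite -addnBAC // -{1}[r - d]addn0 eqn_modDl mod0n eq_sym => qc.
by split.
Qed.

Lemma tail_arc t v : lollipop (tail t) v = (v == tail t.+1).
Proof.
have /andP[pt tp] := tail_bounds t.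
rewrite /lollipop pt tp tail_succ ltnNge pt /= (gtn_eqF (leq_trans p0 pt)).
by rewrite (ltn_eqF tp) orbF.
Qed.

Lemma walk_tail m t v : walk lollipop m (tail t) v <-> v = tail (t + m).
Proof.
elim: m t v => [|m IH] t v; first by rewrite walk0 addn0; split=> ->.
rewrite walkS -addSnnS; split=> [[c]|->]; last first.
  by exists (tail t.+1); [rewrite tail_arc|apply: (IH _ _).2].
by rewrite tail_arc => /eqP->; apply: (IH _ _).1.
Qed.

Lemma head_arc a v : a < p ->
  lollipop a v = (v == a.+1 %% p) || (a == 0) && (v == p).
Proof.
move=> ap; rewrite /lollipop ap leqNgt ap /=.
by rewrite (_ : (a == p + q + d) = false) ?orbF //; lia.
Qed.

Lemma walk_around t a : a < p -> walk lollipop t a ((a + t) %% p).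
Proof.
elim: t a => [|t IH] a ap; first by rewrite walk0 addn0 modn_small.
apply/walkS; exists (a.+1 %% p); first by rewrite /lollipop ap eqxx.
rewrite -addSnnS -modnDml; apply: IH; exact: ltn_pmod.
Qed.

(** The arc from 0 to [p] is the only exit from the first cycle: [t] steps lead to 0, one arc
    crosses, [r] steps remain. *)
Lemma walk_leave m a v : a < p -> p <= v -> walk lollipop m a v ->
  exists t r, [/\ m = (t + 1 + r)%N, p %| a + t & v = tail r].
Proof.
elim: m a => [|m IH] a ap pv; first by move/walk0; lia.
move=> /walkS[c]; rewrite head_arc // => /orP[/eqP->|/andP[/eqP-> /eqP->]].
  case/IH => //; first exact: ltn_pmod.
  move=> t [r [-> pt ->]]; exists t.+1, r; split=> //.
  by move: pt; rewrite /dvdn modnDml addSnnS.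
by rewrite -tail0 => /walk_tail ->; exists 0, m; rewrite dvdn0.
Qed.

Lemma lollipop_branch x a b : lollipop x a -> lollipop x b -> a != b ->
  x = 0 /\ ((a, b) = (1 %% p, p) \/ (a, b) = (p, 1 %% p)) \/
  x = p + q + d /\ a \in ws /\ b \in ws.
Proof.
have [xp|px] := ltnP x p.
  rewrite !head_arc // => /orP[/eqP->|/andP[/eqP-> /eqP->]]
    /orP[/eqP->|/andP[/eqP + /eqP->]];
    rewrite ?eqxx // => *; subst; left; auto.
rewrite /lollipop ltnNge px /= (gtn_eqF (leq_trans p0 px)) /=.
have [xs|] := ltnP x (p + q + d).
  by rewrite (ltn_eqF xs) !orbF => /eqP-> /eqP->; rewrite eqxx.
by move=> _ /= /andP[/eqP-> ?] /andP[_ ?]; right.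
Qed.

(** The walk through the first cycle reaches [p] with a delay of [t + 1] steps, a multiple of [p].
    Both walks can only meet on the second cycle, and then [q] divides the delay too. *)
Lemma branch0_le k v : walk lollipop k (1 %% p) v -> walk lollipop k p v ->
  lcmn p q + d <= k.
Proof.
move=> w1; rewrite -{1}tail0 => /walk_tail ev.
have /andP[pv _] := tail_bounds (0 + k); rewrite -ev in pv.
have [t [r [ek pt er]]] := walk_leave (ltn_pmod 1 p0) pv w1.
have [||dr qt] := @tail_eq r (t + 1); first by rewrite addn1.
  by rewrite -er ev add0n ek addnC.
suff: lcmn p q <= t + 1 by lia.
apply: dvdn_leq; first by rewrite addn1.
by rewrite dvdn_lcm qt andbT; move: pt; rewrite /dvdn modnDml addnC.
Qed.

Lemma fork_branch0 : fork lollipop (lcmn p q + d).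
Proof.
have [/dvdnP[i ei] /dvdnP[j ej]] := (dvdn_lcml p q, dvdn_lcmr p q).
have l0 : 0 < lcmn p q by rewrite lcmn_gt0 p0.
exists 0, (1 %% p), p, (tail d); split; rewrite /lollipop ?p0 ?eqxx ?orbT //.
- by rewrite neq_ltn ltn_pmod.
(* Back to 0 in [lcmn p q - 1] steps, across to [p], then [d] steps along the tail. *)
- have -> : lcmn p q + d = (lcmn p q).-1 + (1 + d) by lia.
  apply: walk_cat (walk_around _ (ltn_pmod 1 p0)) _.
  rewrite modnDml [1 + _.-1]add1n prednK // ei modnMl.
  have arc0 : lollipop 0 p by rewrite head_arc // !eqxx orbT.
  apply: walk_cat (walk1 arc0) _.
  by rewrite -{1}tail0; apply/walk_tail.
rewrite -[X in walk _ _ X]tail0; apply/walk_tail.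
rewrite add0n /tail ltnn ltnNge leq_addl /=.
by rewrite addnK ej modnMl subnn mod0n.
Qed.

Lemma lollipop_bounds n u v : p + q + d <= n ->
  (ws <> [::] -> p + q + d < n) -> (forall w, w \in ws -> w < n) ->
  lollipop u v -> u < n /\ v < n.
Proof.
move=> pn wn wsn /or4P[]/andP[].
- by move=> up /eqP->; have := ltn_pmod u.+1 p0; lia.
- by move=> /eqP-> /eqP->; lia.
- by move=> /andP[pu up] /eqP->; have /andP[_] := tail_bounds (u - p).+1; lia.
by move=> /eqP-> vw; split; [apply: wn; case: ws vw|apply: wsn].
Qed.

End Lollipop.

Lemma Theta_lcm n p q d : 0 < p -> 0 < q -> p + q + d <= n ->
  Theta n (Some (lcmn p q + d)).
Proof.
move=> p0 q0 pn; apply: (@Theta_of_nat_rel _ (lollipop p q d [::])).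
  by move=> u v; apply: lollipop_bounds.
split; first exact: fork_branch0.
move=> j [x [a [b [y [nab xa xb ay by_]]]]].
have [[_ [[ea eb]|[ea eb]]]|[_ [//]]] := lollipop_branch p0 q0 xa xb nab;
  subst a b; exact: branch0_le ay by_ || exact: branch0_le by_ ay.
Qed.

Lemma Theta_le_lcm n p q k : 0 < p -> 0 < q -> p + q < n ->
  0 < k <= lcmn p q -> Theta n (Some k).
Proof.
move=> p0 q0 pqn /andP[k0 kpq].
(* From [tail z], the vertex [p] is reached after [k] steps. *)
have [z qz] : exists z, q %| z + k.
  by exists (q * k - k); rewrite subnK ?dvdn_mulr // leq_pmull.
(* From [x0], the vertex 0 is reached after [k - 1] steps, hence [p] after [k]. *)
have [x0 x0p px0] : exists2 x0, x0 < p & p %| x0 + k.-1.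
  exists ((p * k - k.-1) %% p); first by rewrite ltn_pmod.
  rewrite /dvdn modnDml subnK ?modnMr //.
  by apply: leq_trans (leq_pred k) _; rewrite leq_pmull.
have tb t := @tail_bounds p q 0 p0 q0 t.
apply: (@Theta_of_nat_rel _ (lollipop p q 0 [:: x0; tail p q 0 z])).
  move=> u v; apply: lollipop_bounds => //; try lia.
  by move=> w; rewrite !inE => /orP[]/eqP->; [lia|have := tb z; lia].
set e := lollipop _ _ _ _.
split.
  exists (p + q + 0), x0, (tail p q 0 z), p; split.
  - by have := tb z; lia.
  - by rewrite /e /lollipop eqxx mem_head !orbT.
  - by rewrite /e /lollipop eqxx !inE eqxx !orbT.
  - rewrite -(prednK k0) -addn1; apply: walk_cat (walk_around _ _ _ p0 _ x0p) _.
    by rewrite (eqP px0); apply: walk1; rewrite /e /lollipop !eqxx orbT.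
  apply/walk_tail => //; rewrite -[LHS](tail0 p q 0) /tail !ltn0 !subn0.
  by rewrite (eqP qz) mod0n.
have main j v : walk e j x0 v -> walk e j (tail p q 0 z) v -> k <= j.
  move=> w1 /(walk_tail _ _ p0 q0) ev; have /andP[pv _] := tb (z + j).
  rewrite -ev in pv; have [t [r [ej pt er]]] := walk_leave p0 q0 x0p pv w1.
  have [||_ qt] := @tail_eq p q 0 p0 q0 r (z + (t + 1)); first by lia.
    by rewrite -er ev; congr (tail p q 0 _); lia.
  (* The crossing time [t + 1] is congruent to [k] modulo [p] and modulo [q]; a meeting before [k]
     would make [k - (t + 1)] a positive multiple of the LCM below [k]. *)
  rewrite leqNgt; apply/negP => jk.
  have: lcmn p q %| k - (t + 1).
    rewrite dvdn_lcm; apply/andP; split.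
      by rewrite -{1}(prednK k0) addn1 subSS -(subnDl x0) dvdn_sub.
    by rewrite -(subnDl z) dvdn_sub.
  move=> /dvdn_leq; rewrite subn_gt0 addn1.
  move: (lcmn p q) kpq => N kpq; lia.
move=> j [x [a [b [y [nab xa xb ay by_]]]]].
have [[_ [[ea eb]|[ea eb]]]|[_ []]] := lollipop_branch p0 q0 xa xb nab.
(* Forks at 0 have index at least [lcmn p q], hence at least [k]. *)
- subst a b; apply: leq_trans kpq _; rewrite -[lcmn p q]addn0.
  exact: (branch0_le p0 q0 ay by_).
- subst a b; apply: leq_trans kpq _; rewrite -[lcmn p q]addn0.
  exact: (branch0_le p0 q0 by_ ay).
rewrite !inE => /orP[]/eqP ea /orP[]/eqP eb; subst a b.
- by rewrite eqxx in nab.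
- exact: main ay by_.
- exact: main by_ ay.
by rewrite eqxx in nab.
Qed.

(** * Digraphs whose nontrivial strong components are cycles *)

Lemma path_first_hit (T : eqType) (e : rel T) (S : {pred T}) x s :
  path e x s -> last x s \in S ->
  exists s1 s2, [/\ s = s1 ++ s2, path e x s1, last x s1 \in S &
                    all [predC S] (belast x s1)].
Proof.
elim: s x => [|a s IH] x; first by move=> _ xS; exists [::], [::].
have [xS|xS] := boolP (x \in S); first by exists [::], (a :: s).
move=> /= /andP[xa /IH h] /h[s1 [s2 [-> p1 l1 a1]]].
by exists (a :: s1), s2; split=> //=; rewrite ?xa ?inE ?xS.
Qed.

Lemma uniq_size_leq_card (T : finType) (s : seq T) : uniq s -> size s <= #|T|.
Proof. by move=> us; rewrite -(card_uniqP us) max_card. Qed.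

(* The closed walks through a and through b, taken in the two possible orders;
   the path from b is stopped when it meets the path from a to x. *)
Lemma fork_in_component (T : finType) (e : rel T) x a b :
  e x a -> e x b -> a != b -> connect e a x -> connect e b x ->
  exists2 k, k <= #|T| & fork e k.
Proof.
move=> xa xb nab /connectP[r1 pr1 ep1] /connectP[r2 pr2 ep2].
case: (shortenP pr1) ep1 => p1 pp1 up1 _ ep1 {r1 pr1}.
case: (shortenP pr2) ep2 => p2 pp2 up2 _ ep2 {r2 pr2}.
have [|s1 [s2 [es ps1 ls1 as1]]] := @path_first_hit _ e (mem (a :: p1)) _ _ pp2.
  by rewrite -ep2 ep1 mem_last.
(* The vertices before the first hit avoid [a :: p1], so all of these are distinct. *)
have sz : size (belast b s1 ++ a :: p1) <= #|T|.
  apply: uniq_size_leq_card; rewrite cat_uniq up1 andbT.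
  apply/andP; split.
    have := up2; rewrite es -cat_cons cat_uniq lastI rcons_uniq.
    by case/andP=> /andP[].
  apply/hasPn => z zp; apply/negP => /(allP as1); by rewrite /= zp.
rewrite size_cat size_belast /= in sz.
exists (size p1 + 1 + size s1); first by rewrite addn1 addnC.
have [q1 [q2 lq]] : exists q1 q2, p1 = q1 ++ q2 /\ last a q1 = last b s1.
  by case/splitPl: ls1 => q1 q2 lq; exists q1, q2.
case: lq => [ep lq]; rewrite ep cat_path in pp1; case/andP: pp1 => pq1 pq2.
exists x, a, b, (last b s1); split=> //.
  apply: walk_cat (path_walk ps1); apply: walk_cat (walk1 xb).
  by rewrite ep1; apply: path_walk; rewrite ep cat_path pq1.
have -> : size p1 + 1 + size s1 = size s1 + (size q2 + (1 + size q1)).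
  by rewrite ep size_cat; lia.
apply: walk_cat (path_walk ps1) _.
have wx : walk e (size q2) (last b s1) x.
  by rewrite ep1 ep last_cat -lq; apply: path_walk.
apply: walk_cat wx _; apply: walk_cat (walk1 xa) _.
by rewrite -lq; apply: path_walk.
Qed.

Section Cyclic.
Variables (T : finType) (e : rel T).
Implicit Types (x y z a b : T) (s : seq T).

Definition cyclic : {pred T} := [pred x | [exists y, e x y && connect e y x]].

(** The default [x] makes this a permutation under [succ_uniq], with the strong components as
    orbits; [order succ x] is then the length of the cycle through a cyclic [x]. *)
Definition succ x := odflt x [pick y | e x y && connect e y x].

(** By [fork_in_component], this holds as soon as every fork has index above [#|T|]. *)
Hypothesis succ_uniq : forall x a b, e x a -> e x b ->
  connect e a x -> connect e b x -> a = b.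

Lemma succP x : x \in cyclic -> e x (succ x) /\ connect e (succ x) x.
Proof.
rewrite inE /succ => /existsP[y hy]; case: pickP => [z /andP[]//|/(_ y)].
by rewrite hy.
Qed.

Lemma succE x y : e x y -> connect e y x -> y = succ x.
Proof.
move=> xy yx; have xc : x \in cyclic by apply/existsP; exists y; rewrite xy.
by have [? ?] := succP xc; apply: (@succ_uniq x).
Qed.

Lemma succ_id x : x \notin cyclic -> succ x = x.
Proof.
rewrite /succ; case: pickP => // y hy; case/negP; apply/existsP; by exists y.
Qed.

Lemma arc_cyclic x y : e x y -> connect e y x -> x \in cyclic.
Proof. by move=> xy yx; apply/existsP; exists y; rewrite xy. Qed.

Lemma mutual_cyclic x y : x != y -> connect e x y -> connect e y x -> x \in cyclic.
Proof.
move=> xy /connectP[[|a s] /=]; first by move=> _ exy; rewrite exy eqxx in xy.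
move=> /andP[xa pa] ey yx; apply: (arc_cyclic xa); apply: connect_trans yx.
by apply/connectP; exists s.
Qed.

(** Since [y] leads back to [x], each arc of a path from [x] to [y] stays in the strong component
    and is thus an arc of [succ]. *)
Lemma mutual_fconnect x y : connect e x y -> connect e y x -> fconnect succ x y.
Proof.
move=> /connectP[s ps ey] yx; rewrite {}ey in yx *.
elim: s x ps yx => [|a s IH] x /=; first by rewrite connect0.
move=> /andP[xa ps] lx.
have ax : connect e a x by apply: connect_trans lx; apply/connectP; exists s.
rewrite (succE xa ax); apply: connect_trans (fconnect1 _ _) _.
rewrite -(succE xa ax); apply: IH => //; exact: connect_trans (connect1 xa).
Qed.

Lemma fconnect_connect x y : fconnect succ x y -> connect e x y.
Proof.
apply: connect_sub => a b /eqP <-.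
have [ac|nac] := boolP (a \in cyclic); last by rewrite succ_id.
by have [/connect1] := succP ac.
Qed.

(** Surjectivity suffices on a finite type: a preimage of a cyclic [y] is the last vertex before the
    return to [y] on a closed walk through [y]. *)
Lemma succ_inj : injective succ.
Proof.
have onto y : exists x, succ x == y.
  have [/succP[y1 cy]|yc] := boolP (y \in cyclic); last by exists y; rewrite succ_id.
  have /connectP[s ps es] := cy.
  have : path e y (succ y :: s) by rewrite /= y1.
  rewrite lastI rcons_path -es => /andP[ps1 le].
  exists (last y (belast (succ y) s)); apply/eqP/esym/succE => //.
  by apply/connectP; eexists; first exact: ps1.
have [g gK] := fin_all_exists onto.
have gc : cancel g succ by move=> x; apply/eqP.
exact: can_inj (canF_sym gc).
Qed.

Lemma iter_succ_inj i : injective (iter i succ).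
Proof. by elim: i => // i IH a b /= /succ_inj /IH. Qed.

Lemma succ_fconnect_sym x y : fconnect succ x y = fconnect succ y x.
Proof. exact: fconnect_sym succ_inj x y. Qed.

Lemma cyclic_fconnect x y : x \in cyclic -> fconnect succ x y -> y \in cyclic.
Proof.
move=> xc xy; have [<-//|nxy] := eqVneq x y.
apply: (@mutual_cyclic y x); first by rewrite eq_sym.
  by apply: fconnect_connect; rewrite succ_fconnect_sym.
exact: fconnect_connect.
Qed.

Lemma cyclic_iter x i : x \in cyclic -> iter i succ x \in cyclic.
Proof. by move=> xc; apply: cyclic_fconnect xc (fconnect_iter _ _ _). Qed.

Lemma path_traject x c : x \in cyclic -> path e x (traject succ (succ x) c).
Proof.
elim: c x => [//|c IH] x xc /=; have [-> _] := succP xc.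
exact: IH (cyclic_iter 1 xc).
Qed.

Lemma walk_iter x i : x \in cyclic -> walk e i x (iter i succ x).
Proof.
move=> xc; exists (traject succ (succ x) i).
by rewrite path_traject // size_traject last_traject.
Qed.

Lemma iter_dvd_order x i : order succ x %| i -> iter i succ x = x.
Proof.
case/dvdnP=> j ->; elim: j => [//|j IH].
by rewrite mulSn iterD IH iter_order //; apply: succ_inj.
Qed.

Lemma order_fconnect x y : fconnect succ x y -> order succ y = order succ x.
Proof.
move=> xy; apply: eq_card => z; rewrite !inE; apply/idP/idP; apply: connect_trans => //.
by rewrite succ_fconnect_sym.
Qed.

Lemma size_orbits x y s : uniq s -> {in s, forall z, ~~ fconnect succ x z} ->
  {in s, forall z, ~~ fconnect succ y z} -> ~~ fconnect succ x y ->
  size s + (order succ x + order succ y) <= #|T|.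
Proof.
move=> us sx sy xy; rewrite -!size_orbit -!size_cat.
apply: uniq_size_leq_card; rewrite !cat_uniq us !orbit_uniq /= andbT.
apply/andP; split.
  apply/hasPn=> z; rewrite mem_cat -!fconnect_orbit => zxy.
  apply/negP => zs; move: zxy; by rewrite (negPf (sx _ zs)) (negPf (sy _ zs)).
apply/hasPn=> z; rewrite /= -!fconnect_orbit => yz; apply/negP => xz.
by case/negP: xy; apply: connect_trans xz _; rewrite succ_fconnect_sym.
Qed.

End Cyclic.

(** * A cycle leading to another cycle *)

Section TwoCycles.
Variables (T : finType) (e : rel T).
Hypothesis succ_uniq : forall x a b : T, e x a -> e x b ->
  connect e a x -> connect e b x -> a = b.
Implicit Types (x y z a b : T) (s : seq T).
Local Notation f := (succ e).
Local Notation cyclic := (cyclic e).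

(** Take a shortest path between the two cycles: meeting the first again would allow a later start,
    meeting the second early an earlier stop. *)
Lemma shortest_bridge x y : x \in cyclic -> y \in cyclic ->
  ~~ fconnect f x y -> connect e x y -> exists a b s,
  [/\ fconnect f x a, e a b, path e b s & fconnect f y (last b s)] /\
  [/\ ~~ fconnect f x b, uniq (belast b s),
      {in belast b s, forall z, ~~ fconnect f x z} &
      {in belast b s, forall z, ~~ fconnect f y z}].
Proof.
move=> xc yc nxy xy.
pose P d := `[< exists a s,
  [/\ fconnect f x a, path e a s, fconnect f y (last a s) & size s = d] >].
have exP : exists d, P d.
  case/connectP: xy => s ps es; exists (size s); apply/asboolP; exists x, s.
  by rewrite -es !connect0.
case: (ex_minnP exP) => d /asboolP[a [s0 [xa ps0 ys0 sd]]] dmin.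
have {}dmin a' s' : fconnect f x a' -> path e a' s' -> fconnect f y (last a' s') ->
    size s0 <= size s'.
  by move=> xa' ps' ys'; rewrite sd; apply: dmin; apply/asboolP; exists a', s'.
move: ys0 dmin sd; case: (shortenP ps0) => s ps us sub ys dmin _.
have {dmin} dmin a' s' : fconnect f x a' -> path e a' s' ->
    fconnect f y (last a' s') -> size s <= size s'.
  move=> xa' ps' ys'; apply: leq_trans (dmin _ _ xa' ps' ys').
  by apply: uniq_leq_size => //; case/andP: us.
case: s ps us ys dmin {sub} => [|b s] /=.
  move=> _ _ ya; case/negP: nxy; apply: connect_trans xa _.
  by rewrite succ_fconnect_sym.
move=> /andP[ab ps] /andP[_ us] ys dmin; exists a, b, s.
have nx s1 s2 z : b :: s = s1 ++ z :: s2 -> ~~ fconnect f x z.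
  move=> es; apply/negP => xz.
  have: path e a (b :: s) by rewrite /= ab.
  rewrite es cat_path => /andP[_ /= /andP[_ pz]].
  have := dmin z s2 xz pz; rewrite -[(size s).+1]/(size (b :: s)) es size_cat /=.
  have -> : last z s2 = last a (b :: s) by rewrite es last_cat.
  by move/(_ ys); rewrite addnS ltnNge leq_addl.
have us' : uniq (belast b s)
  by have := us : uniq (b :: s); rewrite lastI rcons_uniq => /andP[].
split; split=> //; first exact: (nx [::] s).
  by move=> z /splitPr zs; case: zs (lastI b s) => s1 s2; rewrite rcons_cat; apply: nx.
move=> z /splitPr zs; case: zs (lastI b s) => s1 s2; rewrite rcons_cat /= => es.
apply/negP => yz; have: path e a (b :: s) by rewrite /= ab.
rewrite es -cat_rcons cat_path => /andP[pz _].
have := dmin a (rcons s1 z) xa pz; rewrite last_rcons => /(_ yz).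
rewrite -[(size s).+1]/(size (b :: s)) es size_cat size_rcons /=.
by rewrite size_rcons !addnS ltnS ltnNge leq_addr.
Qed.

(** From [a], one walk turns [L] steps around the first cycle and then follows the bridge; the other
    follows the bridge and then turns [L] steps around the second. The inner vertices of the bridge
    avoid both cycles, which bounds [size s]. *)
Lemma bridge_fork_le x y : x \in cyclic -> y \in cyclic ->
  ~~ fconnect f x y -> connect e x y ->
  exists2 k, k + order f x + order f y <= lcmn (order f x) (order f y) + #|T| &
             fork e k.
Proof.
move=> xc yc nxy xy.
have [a [b [s [[xa ab ps ys] [nxb us sx sy]]]]] := shortest_bridge xc yc nxy xy.
move ez: (last b s) ys => z ys.
set L := lcmn _ _.
have oa : order f a = order f x.
  exact: (order_fconnect succ_uniq xa).
have oz : order f z = order f y.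
  exact: (order_fconnect succ_uniq ys).
have ac := cyclic_fconnect succ_uniq xc xa.
have zc := cyclic_fconnect succ_uniq yc ys.
have L0 : 0 < L by rewrite lcmn_gt0 !order_gt0.
exists (L + size s).
  rewrite -!addnA leq_add2l.
  by have := size_orbits succ_uniq us sx sy nxy; rewrite size_belast.
exists a, (f a), b, z; split=> //.
- apply: contraNneq nxb => <-; apply: connect_trans xa _; exact: fconnect1.
- by have [] := succP ac.
- have -> : L + size s = L.-1 + (1 + size s) by rewrite add1n addnS -addSn prednK.
  apply: walk_cat (walk_iter _ _ _) _ => //.
    by have := cyclic_iter succ_uniq 1 ac.
  rewrite -iterSr prednK // iter_dvd_order ?oa ?dvdn_lcml //.
  by apply: walk_cat (walk1 ab) _; rewrite -ez; apply: path_walk.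
rewrite addnC; apply: walk_cat (path_walk ps) _.
rewrite ez -[X in walk e _ _ X](@iter_dvd_order _ _ succ_uniq z L) ?oz ?dvdn_lcmr //.
exact: walk_iter.
Qed.

Section Bipartition.
Variables (x y : T).
Hypotheses (xc : x \in cyclic) (yc : y \in cyclic).
Hypotheses (nxy : ~~ fconnect f x y) (xy : connect e x y).
Hypothesis cover : order f x + order f y = #|T|.
Local Notation p := (order f x).
Local Notation q := (order f y).

Lemma cover_or z : fconnect f x z \/ fconnect f y z.
Proof.
apply/orP; apply/negPn/negP; rewrite negb_or => /andP[nx ny].
have := @size_orbits _ _ succ_uniq x y [:: z] isT.
have h w : ~~ fconnect f w z -> {in [:: z], forall u, ~~ fconnect f w u}.
  by move=> ? u; rewrite inE => /eqP->.
by move=> /(_ (h _ nx) (h _ ny) nxy); rewrite cover add1n ltnn.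
Qed.

Lemma no_return a b : fconnect f x a -> fconnect f y b -> ~~ connect e b a.
Proof.
move=> xa yb; apply/negP => ba; case/negP: nxy.
apply: mutual_fconnect => //.
apply: connect_trans (fconnect_connect yb) _; apply: connect_trans ba _.
by apply: fconnect_connect; rewrite succ_fconnect_sym.
Qed.

Lemma y_arc u v : fconnect f y u -> e u v -> v = f u.
Proof.
move=> yu uv; have [xv|yv] := cover_or v.
  by have := no_return xv yu; rewrite connect1.
apply: succE => //; apply: fconnect_connect.
by rewrite succ_fconnect_sym //; apply: connect_trans yv; rewrite succ_fconnect_sym.
Qed.

Lemma x_arc u v : fconnect f x u -> e u v -> fconnect f x v -> v = f u.
Proof.
move=> xu uv xv; apply: succE => //; apply: fconnect_connect.
by rewrite succ_fconnect_sym //; apply: connect_trans xv; rewrite succ_fconnect_sym.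
Qed.

Lemma y_walk m u v : fconnect f y u -> walk e m u v -> v = iter m f u.
Proof.
elim: m u => [|m IH] u yu; first by move/walk0.
move=> /walkS[w uw]; rewrite (y_arc yu uw) iterSr; apply: IH.
by apply: connect_trans yu _; apply: fconnect1.
Qed.

(** There is no way back from the second cycle, so a walk crosses at most once and [succ] dictates
    all its other steps. *)
Lemma x_walk m u v : fconnect f x u -> walk e m u v ->
  fconnect f x v /\ v = iter m f u \/
  exists a b t r, [/\ m = t + 1 + r, a = iter t f u, e a b &
                      fconnect f y b /\ v = iter r f b].
Proof.
elim: m u => [|m IH] u xu; first by move/walk0 <-; left.
move=> /walkS[w uw wv]; have [xw|yw] := cover_or w; last first.
  right; exists u, w, 0, m; split=> //; split=> //; exact: y_walk wv.
have [[xv ev]|] := IH w xw wv.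
  by left; split=> //; rewrite iterSr -(x_arc xu uw xw).
move=> [a [b [t [r [-> -> ab yb]]]]]; right; exists (iter t f w), b, t.+1, r.
by split=> //; rewrite iterSr -(x_arc xu uw xw).
Qed.

(* Both branches of a fork end on the second cycle: one crosses at once, the
   other after t more steps. *)
Lemma fork_parallel_arcs k : fork e k -> exists a b t,
  [/\ fconnect f x a, fconnect f y b, e a b, e (iter t f a) (iter t f b) &
      0 < t <= k].
Proof.
move=> [u [a [b [v [nab ua ub wa wb]]]]].
have [xu|yu] := cover_or u; last by rewrite (y_arc yu ua) (y_arc yu ub) eqxx in nab.
have main c d : fconnect f x c -> fconnect f y d -> e u c -> e u d ->
    walk e k c v -> walk e k d v -> exists a b t,
    [/\ fconnect f x a, fconnect f y b, e a b, e (iter t f a) (iter t f b) &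
        0 < t <= k].
  move=> xc' yd uc ud wc /(y_walk yd) vd.
  have [[xv _]|] := x_walk xc' wc.
    have := no_return xv yd; rewrite vd fconnect_connect //; exact: fconnect_iter.
  move=> [c' [d' [t [r [ek ec cd [yd' vr]]]]]]; exists u, d, t.+1; split=> //.
    (* Both vertices reach [v] after [r] further steps, and [iter r f] is injective. *)
    have -> : iter t.+1 f d = d'.
      apply: (iter_succ_inj succ_uniq (i := r)).
      by rewrite -iterD -vr vd ek; congr (iter _ f d); rewrite addn1 addnC.
    by rewrite iterSr -(x_arc xu uc xc') -ec.
  by rewrite ek addn1 leq_addr.
have [xa|ya] := cover_or a; have [xb|yb] := cover_or b.
- by rewrite (x_arc xu ua xa) (x_arc xu ub xb) eqxx in nab.
- exact: main ua ub wa wb.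
- exact: main ub ua wb wa.
have ev : iter k f a = iter k f b by rewrite -(y_walk ya wa) -(y_walk yb wb).
by rewrite (iter_succ_inj succ_uniq ev) eqxx in nab.
Qed.

(** One walk crosses at once and follows the second cycle for [t] steps; the other follows the first
    cycle and crosses by the second arc. *)
Lemma parallel_arcs_fork a b t : fconnect f x a -> fconnect f y b -> e a b ->
  e (iter t f a) (iter t f b) -> 0 < t -> fork e t.
Proof.
move=> xa yb ab tab t0; have ac := cyclic_fconnect succ_uniq xc xa.
exists a, (f a), b, (iter t f b); split=> //.
- apply/eqP => fab; case/negP: nxy; apply: connect_trans xa _.
  apply: connect_trans (fconnect1 _ _) _; rewrite fab.
  by rewrite succ_fconnect_sym.
- by have [] := succP ac.
- case: t t0 tab => // t _ tab; rewrite -addn1.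
  apply: walk_cat (walk_iter succ_uniq t (cyclic_iter succ_uniq 1 ac)) _.
  by apply: walk1; rewrite -iterSr addn1.
exact: (walk_iter succ_uniq _ (cyclic_fconnect succ_uniq yc yb)).
Qed.

Lemma least_fork_bipartition k : least_fork e k ->
  k = lcmn p q \/ k.*2 <= lcmn p q.
Proof.
move=> [fk kmin]; have [a [b [t [xa yb ab tab /andP[t0 tk]]]]] := fork_parallel_arcs fk.
(* As the two cycles cover [T], the bound of [bridge_fork_le] is exactly the LCM. *)
have kL : k <= lcmn p q.
  have [j jL /kmin kj] := bridge_fork_le xc yc nxy xy.
  by move: jL; rewrite -cover -addnA leq_add2r; apply: leq_trans.
have tL : t <= lcmn p q by apply: leq_trans kL.
have [oa ob] : order f a = p /\ order f b = q.
  by split; apply: order_fconnect.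
have iL c : (c = a \/ c = b) -> iter (lcmn p q - t) f (iter t f c) = c.
  rewrite -iterD subnK // => -[] ->; apply: iter_dvd_order => //.
    by rewrite oa dvdn_lcml.
  by rewrite ob dvdn_lcmr.
move: (tL); rewrite leq_eqVlt => /orP[/eqP et|tltL].
  by left; apply/eqP; rewrite eqn_leq kL -et.
(* The two arcs are also L - t steps apart in the opposite order, so that
   k <= min(t, L - t). *)
right; have kt := kmin _ (parallel_arcs_fork xa yb ab tab t0).
suff /kmin kLt : fork e (lcmn p q - t).
  by rewrite -addnn; apply: leq_trans (leq_add kLt kt) _; rewrite subnK.
apply: (@parallel_arcs_fork (iter t f a) (iter t f b)) => //.
- by apply: connect_trans xa _; apply: fconnect_iter.
- by apply: connect_trans yb _; apply: fconnect_iter.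
- by rewrite !iL; auto.
by rewrite subn_gt0.
Qed.

End Bipartition.
End TwoCycles.

(** * No cycle leading to another cycle *)

Section NoBridge.
Variables (T : finType) (e : rel T).
Hypothesis succ_uniq : forall x a b : T, e x a -> e x b ->
  connect e a x -> connect e b x -> a = b.
Implicit Types (x y z a b u : T) (s r : seq T).
Local Notation f := (succ e).
Local Notation cyclic := (cyclic e).
Local Notation acyclic := [predC cyclic].

(** A vertex visited twice lies on a closed walk. *)
Lemma path_uniq_acyclic u s : path e u s -> uniq (filter acyclic (u :: s)).
Proof.
elim: s u => [|a s IH] u; first by move=> _ /=; case: ifP.
move=> /= /andP[ua ps]; have /= := IH a ps.
rewrite -[if _ then _ else _]/(filter acyclic (a :: s)) => us.
case: ifP => // nu; rewrite cons_uniq us andbT mem_filter negb_and.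
apply/orP; right; apply/negP => /(path_connect ps) au.
by case/negP: nu; apply: arc_cyclic ua au.
Qed.

Lemma acyclic_uniq_orbit x s : x \in cyclic -> uniq s -> all acyclic s ->
  size s + order f x <= #|T|.
Proof.
move=> xc us sn; rewrite -size_orbit -size_cat; apply: uniq_size_leq_card.
rewrite cat_uniq us orbit_uniq andbT; apply/hasPn => z.
rewrite -fconnect_orbit => xz; apply/negP => /(allP sn) /negP[].
exact: (cyclic_fconnect succ_uniq xc xz).
Qed.

Lemma acyclic_uniq_orbits x y s : x \in cyclic -> y \in cyclic ->
  ~~ fconnect f x y -> uniq s -> all acyclic s ->
  size s + (order f x + order f y) <= #|T|.
Proof.
move=> xc yc nxy us sn; apply: size_orbits => //.
  move=> z /(allP sn)/negP zn; apply/negP => /(cyclic_fconnect succ_uniq xc); exact: zn.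
move=> z /(allP sn)/negP zn; apply/negP => /(cyclic_fconnect succ_uniq yc); exact: zn.
Qed.

(** Under [pumpable], [s1] leads to the first cyclic vertex, [c] steps follow its cycle and [s2] is
    the acyclic rest. Changing [c] by whole turns keeps the endpoints. *)
Definition pumped u s1 c s2 := s1 ++ traject f (f (last u s1)) c ++ s2.

Definition pumpable u s1 s2 :=
  [/\ last u s1 \in cyclic, all acyclic (belast u s1) & all acyclic s2].

Lemma size_pumped u s1 c s2 : size (pumped u s1 c s2) = size s1 + c + size s2.
Proof. by rewrite /pumped !size_cat size_traject addnA. Qed.

Lemma pumped_sub u s1 c s2 i : order f (last u s1) %| i -> i <= c ->
  path e u (pumped u s1 c s2) -> last u s1 \in cyclic ->
  path e u (pumped u s1 (c - i) s2) /\
  last u (pumped u s1 (c - i) s2) = last u (pumped u s1 c s2).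
Proof.
move=> oi ic; rewrite /pumped !cat_path !last_cat !last_traject.
move=> /and3P[-> _ ps2] xc; rewrite path_traject //=.
have -> : iter (c - i) f (last u s1) = iter c f (last u s1).
  by rewrite -{2}(subnK ic) iterD (iter_dvd_order succ_uniq oi).
by rewrite ps2.
Qed.

(* s1 is recovered from the walk as the part before its first cyclic vertex. *)
Lemma pumped_inj u s1 c s2 s1' c' s2' i : pumpable u s1 s2 -> pumpable u s1' s2' ->
  order f (last u s1) %| i -> i <= c -> i <= c' ->
  pumped u s1 (c - i) s2 = pumped u s1' (c' - i) s2' ->
  pumped u s1 c s2 = pumped u s1' c' s2'.
Proof.
move=> [xc a1 _] [xc' a1' _] oi ic ic' eqp.
have sz r t : last u r \in cyclic -> all acyclic (belast u r) ->
    find (mem cyclic) (u :: r ++ t) = size r.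
  move=> rc ra; rewrite -cat_cons lastI cat_rcons find_cat.
  have /negbTE -> : ~~ has (mem cyclic) (belast u r) by rewrite -all_predC.
  by rewrite /= rc addn0 size_belast.
have es : size s1 = size s1'.
  by have := congr1 (fun r => find (mem cyclic) (u :: r)) eqp; rewrite /pumped !sz.
have es1 : s1 = s1'.
  by have := congr1 (take (size s1)) eqp; rewrite {2}es !take_size_cat.
subst s1'; have := congr1 (drop (size s1)) eqp; rewrite !drop_size_cat // => eqd.
(* The removed part depends only on [s1] and [i], so it can be put back into both walks. *)
have split_traject d : i <= d -> traject f (f (last u s1)) d =
    traject f (f (last u s1)) i ++ traject f (f (last u s1)) (d - i).
  move=> id; rewrite -{1}(subnKC id) trajectD -iterSr iterS.
  by rewrite (iter_dvd_order succ_uniq oi).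
by rewrite /pumped !(split_traject c, split_traject c') // -!catA eqd.
Qed.

Hypothesis no_bridge : forall x y : T, x \in cyclic -> y \in cyclic ->
  connect e x y -> fconnect f x y.

(** After leaving its cycle the walk meets no cyclic vertex: by [no_bridge] that vertex would lie on
    the same cycle, and so the walk would never have left the component. *)
Lemma cyclic_path x s : x \in cyclic -> path e x s ->
  exists c s2, s = traject f (f x) c ++ s2 /\ all acyclic s2.
Proof.
elim: s x => [|a s IH] x xc; first by exists 0, [::].
move=> /= /andP[xa ps]; have [ac|nac] := boolP (a \in cyclic).
  have ax : connect e a x.
    have := no_bridge xc ac (connect1 xa); rewrite succ_fconnect_sym //.
    exact: fconnect_connect.
  have ea := succE succ_uniq xa ax; have [c [s2 [-> a2]]] := IH a ac ps.
  by exists c.+1, s2; rewrite ea.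
exists 0, (a :: s); split=> //; apply/allP => z zs; apply/negP => zc.
have az : connect e a z := path_connect ps zs.
have : fconnect f x z by apply: no_bridge => //; apply: connect_trans (connect1 xa) az.
rewrite succ_fconnect_sym // => /fconnect_connect zx.
case/negP: (nac); apply: (@mutual_cyclic _ _ _ z) => //.
  by apply: contraNneq nac => ->.
exact: connect_trans zx (connect1 xa).
Qed.

Lemma path_pumped u s : path e u s -> all acyclic (u :: s) \/
  exists s1 c s2, s = pumped u s1 c s2 /\ pumpable u s1 s2.
Proof.
have from_cyclic v r : v \in cyclic -> path e v r ->
    exists s1 c s2, r = pumped v s1 c s2 /\ pumpable v s1 s2.
  by move=> vc /(cyclic_path vc)[c [s2 [-> a2]]]; exists [::], c, s2.
elim: s u => [|a s IH] u ps; have [uc|nuc] := boolP (u \in cyclic);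
  try by right; apply: from_cyclic.
  by left; rewrite /= nuc.
move: ps => /= /andP[ua /IH[as_|[s1 [c [s2 [-> [xc a1 a2]]]]]]].
  by left; rewrite /= nuc.
by right; exists (a :: s1), c, s2; split=> //; split=> //=; rewrite nuc.
Qed.

Lemma pumpable_uniq u s1 c s2 : path e u (pumped u s1 c s2) ->
  pumpable u s1 s2 -> uniq (belast u s1 ++ s2) /\ all acyclic (belast u s1 ++ s2).
Proof.
move=> ps [xc a1 a2]; rewrite all_cat a1 a2; split=> //.
have := path_uniq_acyclic ps.
rewrite /pumped -cat_cons lastI cat_rcons !filter_cat /= xc /= filter_cat.
rewrite (all_filterP a1) (all_filterP a2).
have : ~~ has acyclic (traject f (f (last u s1)) c).
  apply/hasPn=> z /trajectP[i _ ->]; rewrite /= negbK -iterSr.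
  exact: (cyclic_iter succ_uniq).
by rewrite has_filter negbK => /eqP->.
Qed.

Lemma least_fork_no_bridge k : least_fork e k -> #|T| <= k -> exists x y,
  [/\ x \in cyclic, y \in cyclic, ~~ fconnect f x y,
      order f x + order f y < #|T| &
      k + order f x + order f y <= lcmn (order f x) (order f y) + #|T|].
Proof.
move=> [fk kmin] nk.
have [u [r1 [r2 [[pr1 pr2] [z1 z2] lr ne]]]] := fork_neq_walks fk.
(* A walk avoiding all cycles would have [k + 2] distinct vertices, more than [#|T|]. *)
have decomp r : path e u r -> size r = k.+1 ->
    exists s1 c s2, r = pumped u s1 c s2 /\ pumpable u s1 s2.
  move=> pr zr; have [ar|//] := path_pumped pr.
  have := path_uniq_acyclic pr; rewrite (all_filterP ar) => /uniq_size_leq_card.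
  by rewrite /= zr => /ltnW; rewrite ltnNge nk.
have [s1 [c [s2 [er pu]]]] := decomp r1 pr1 z1.
have [s1' [c' [s2' [er' pu']]]] := decomp r2 pr2 z2.
subst r1 r2; have [us as_] := pumpable_uniq pr1 pu.
have [us' as_'] := pumpable_uniq pr2 pu'.
have [[xc0 a1 _] [xc0' a1' _]] := (pu, pu').
rewrite !size_pumped in z1 z2.
move ex: (last u s1) (xc0) => x xc; move ex' : (last u s1') (xc0') => x' xc'.
pose L := lcmn (order f x) (order f x').
have L0 : 0 < L by rewrite lcmn_gt0 !order_gt0.
have sizeB m n1 i n2 : m <= i -> n1 + i + n2 = k.+1 -> n1 + (i - m) + n2 = k.+1 - m.
  by clear; lia.
(* Otherwise L steps can be removed from both walks. *)
have small : c < L \/ c' < L.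
  apply/orP; rewrite !ltnNge -negb_and; apply/negP => /andP[Lc Lc'].
  have [oL oL'] : order f (last u s1) %| L /\ order f (last u s1') %| L.
    by rewrite ex ex' dvdn_lcml dvdn_lcmr.
  have [q1 l1] := pumped_sub oL Lc pr1 xc0.
  have [q2 l2] := pumped_sub oL' Lc' pr2 xc0'.
  have [|||j jk /kmin kj] := neq_walks_fork q1 q2.
  - by rewrite !size_pumped !sizeB.
  - by rewrite l1 l2.
  - by move=> /(pumped_inj pu pu' oL Lc Lc').
  move: jk; rewrite size_pumped sizeB // => /(leq_ltn_trans kj).
  by rewrite ltn_subRL ltnS -{2}[k]add0n leq_add2r leqNgt L0.
(* On a common cycle [L] is its length, so the walk winding less than [L] has length below [#|T|],
   against [#|T| <= k]. *)
have [xx'|nxx'] := boolP (fconnect f x x').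
  have oxx : order f x' = order f x := order_fconnect succ_uniq xx'.
  have eL : L = order f x by rewrite /L oxx /lcmn gcdnn mulnK ?order_gt0.
  have bnd r1 i r2 v : v \in cyclic -> order f v = L -> uniq (belast u r1 ++ r2) ->
      all acyclic (belast u r1 ++ r2) -> size r1 + i + size r2 = k.+1 -> i < L -> False.
    move=> vc ov ur ar zr iL; have := acyclic_uniq_orbit vc ur ar.
    rewrite size_cat size_belast ov -addnA addnC => /leq_trans/(_ nk).
    by move: zr iL; move: (L) (size r1) (size r2) => m n1 n2; clear; lia.
  by case: small => [cL|cL];
    [case: (bnd s1 c s2 x)|case: (bnd s1' c' s2' x')]; rewrite ?oxx.
have bnd r1 i r2 : uniq (belast u r1 ++ r2) -> all acyclic (belast u r1 ++ r2) ->
    size r1 + i + size r2 = k.+1 -> i < L -> k + order f x + order f x' <= L + #|T|.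
  move=> ur ar zr iL; have := acyclic_uniq_orbits xc xc' nxx' ur ar.
  rewrite size_cat size_belast; move: zr iL; rewrite -(addnA k).
  move: (L) (order f x + _) (size r1) (size r2) #|T| => m o n1 n2 n; clear; lia.
exists x, x'; split=> //; last first.
  by case: small => [cL|cL]; [apply: (bnd s1 c s2)|apply: (bnd s1' c' s2')].
(* If [u] were cyclic, both walks would wind around its own cycle. So [u] lies outside the two
   cycles and the inequality is strict. *)
have nu : u \notin cyclic.
  apply/negP => uc; have nil r : all acyclic (belast u r) -> r = [::].
    by case: r => //= b r; rewrite uc.
  by case/negP: nxx'; rewrite -ex -ex' (nil _ a1) (nil _ a1') connect0.
have := @acyclic_uniq_orbits x x' [:: u] xc xc' nxx' isT.
by rewrite /= nu => /(_ isT).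
Qed.

End NoBridge.

Lemma least_fork_bound (T : finType) (e : rel T) k : least_fork e k ->
  k <= #|T| \/ exists p q, [/\ 0 < p, 0 < q, p + q <= #|T|,
    k + p + q <= lcmn p q + #|T| &
    p + q = #|T| -> k = lcmn p q \/ k.*2 <= lcmn p q].
Proof.
move=> lfk; have [fk kmin] := lfk; have [kn|nk] := leqP k #|T|; [by left|right].
have succ_uniq x a b : e x a -> e x b -> connect e a x -> connect e b x -> a = b.
  move=> xa xb ax bx; apply/eqP/negPn/negP => nab.
  have [j jn /kmin kj] := fork_in_component xa xb nab ax bx.
  by have := leq_trans kj jn; rewrite leqNgt nk.
have [[x [y [xc yc xy nxy]]]|nbridge] := pselect (exists x y,
    [/\ x \in cyclic e, y \in cyclic e, connect e x y & ~~ fconnect (succ e) x y]).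
  exists (order (succ e) x), (order (succ e) y); split; rewrite ?order_gt0 //.
  - exact: (@acyclic_uniq_orbits _ _ succ_uniq x y [::]).
  - have [j jL /kmin kj] := bridge_fork_le succ_uniq xc yc nxy xy.
    by apply: leq_trans jL; rewrite -!addnA leq_add2r.
  by move=> cover; apply: least_fork_bipartition.
have no_bridge x y : x \in cyclic e -> y \in cyclic e -> connect e x y ->
    fconnect (succ e) x y.
  by move=> xc yc xy; apply/negPn/negP => nxy; apply: nbridge; exists x, y.
have [x [y [xc yc nxy pq kpq]]] := least_fork_no_bridge succ_uniq no_bridge lfk (ltnW nk).
exists (order (succ e) x), (order (succ e) y); split; rewrite ?order_gt0 //.
  exact: ltnW.
by move=> cover; rewrite cover ltnn in pq.
Qed.

(** * The set of stable indices *)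

Lemma lcmn_coprime p q : coprime p q -> lcmn p q = p * q.
Proof. by move=> /eqP g1; rewrite -muln_lcm_gcd g1 muln1. Qed.

Lemma Theta_bound n k : Theta n (Some k) ->
  k <= n \/ exists p q, [/\ 0 < p, 0 < q, p + q <= n,
    k + p + q <= lcmn p q + n &
    p + q = n -> k = lcmn p q \/ k.*2 <= lcmn p q].
Proof.
by move=> /Theta_least_fork[e /least_fork_bound]; rewrite card_ord.
Qed.

Section MaxStableIndex.
Variable N : nat.
Hypothesis N6 : 6 <= N.
Local Notation s := (max_stable_index N).

Lemma lcm_le_max p q : 0 < p -> 0 < q -> p + q <= N ->
  lcmn p q + N <= s + (p + q).
Proof.
move=> p0 q0 pqN; have [_ smax] := max_stable_indexP (leq_trans (isT : 1 < 6) N6).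
have /smax : [set k | Theta N (Some k)] (lcmn p q + (N - (p + q))).
  by apply: Theta_lcm => //; rewrite subnKC.
by move: (lcmn p q); lia.
Qed.

Lemma max_le_lcm : exists p q, [/\ 0 < p, 0 < q, p + q <= N &
  s + (p + q) <= lcmn p q + N].
Proof.
have [/Theta_bound sT _] := max_stable_indexP (leq_trans (isT : 1 < 6) N6).
case: sT => [sN|[p [q [p0 q0 pqN]]]]; last by rewrite -addnA; exists p, q.
(* If [s <= N], this pair suffices: [6 + N - 5] exceeds [N]. *)
exists 2, 3; split=> //; first by lia.
by rewrite (_ : lcmn 2 3 = 6) //; lia.
Qed.

Lemma half_lcm_le_max p q k : p + q = N.+1 -> k.*2 <= lcmn p q -> k <= s.+1.
Proof.
move=> pqN kpq; have {}kpq : k.*2 <= p * q.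
  apply: leq_trans kpq _; rewrite -muln_lcm_gcd.
  case: p q {pqN} => [|p] q; first by rewrite /lcmn mul0n div0n.
  by rewrite leq_pmulr // gcdn_gt0.
(* Consecutive integers are coprime, so below order [N] their LCM is about [N^2/4], enough against
   half of [p * q <= (N + 1)^2/4]. *)
have consec h : 0 < h -> h + h.+1 <= N -> h * h.+1 + N <= s + (h + h.+1).
  move=> h0 hN; rewrite -lcmn_coprime ?coprimenS //; exact: lcm_le_max.
have [h [h2 Nh]] : exists h, 2 < h /\ (N = h.*2 \/ N = h.*2.+1).
  by exists N./2; move: (odd_double_half N); case: (odd N); lia.
case: Nh => eN.
  have := consec h.-1; rewrite prednK ?(ltnW (ltnW h2)) //.
  by case: h h2 eN => // h h2 eN; nia.
by have := consec h; nia.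
Qed.

End MaxStableIndex.

Unset Implicit Arguments.

Theorem theorem3 (n : nat) (hn : 7 <= n) :
  Theta n =
    [set Some k | k in [set k : nat | 1 <= k <= max_stable_index (n - 1) + 1]]
    `|` [set t | exists p q : nat,
           [/\ 0 < p, 0 < q, p + q = n & t = Some (lcmn p q)]]
    `|` [set None].
Proof.
case: n hn => // N N6; rewrite subn1 /= addn1.
have [p [q [p0 q0 pqN sL]]] := max_le_lcm N6.
apply/seteqP; split=> [[k|] Tk|t].
- have k0 : 0 < k by have /Theta_least_fork[e [/fork_gt0]] := Tk.
  left; have [kN|[a [b [a0 b0 abn kL tight]]]] := Theta_bound Tk.
    left; exists k => //=; rewrite k0 (leq_trans kN) //.
    (* The cycle lengths 2 and 3 give [s >= N + 1]. *)
    have := lcm_le_max N6 (isT : 0 < 2) (isT : 0 < 3) (ltnW N6).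
    by rewrite (_ : lcmn 2 3 = 6) //; lia.
  move: abn; rewrite leq_eqVlt => /orP[/eqP abn|abN].
    have [->|k2] := tight abn; first by right; exists a, b.
    by left; exists k => //=; rewrite k0 (half_lcm_le_max N6 abn k2).
  left; exists k => //=; rewrite k0.
  by move: (lcm_le_max N6 a0 b0 abN) kL; move: (lcmn a b); lia.
- by right.
case=> [[[k /= /andP[k0 ks] <-]|[a [b [a0 b0 ab ->]]]]|->].
(* With [p], [q] attaining [s], values up to the LCM use the extra vertex; larger ones lengthen the
   path between the cycles, up to [s + 1] in order [N + 1]. *)
- have [kL|Lk] := leqP k (lcmn p q).
    by apply: (Theta_le_lcm p0 q0) => //; rewrite k0.
  rewrite -(subnKC (ltnW Lk)); apply: Theta_lcm => //.
  by move: Lk ks sL; move: (lcmn p q); lia.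
- by rewrite -[lcmn a b]addn0; apply: Theta_lcm; rewrite ?addn0 ?ab.
exact: Theta_None.
Qed.
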